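(* Let $p$ be a prime and let $P(p-1)$ denote the number of integer partitions of $p-1$. (i) If $P(p-1) \not\equiv 1 \pmod p$, then for every integer $j \ge 1$, with $n = p^2 j - p - 1$, the number of coefficients of $p_n(b)$ congruent to $r$ modulo $p$ is the same for every $r \in \{1,2,\dots,p-1\}$. (ii) If $P(p-1) \equiv 1 \pmod p$, then for every integer $j \ge 1$, with $n = p^3 j - p^2 - p - 1$, the number of coefficients of $p_n(b)$ congruent to $r$ modulo $p$ is the same for every $r \in \{1,2,\dots,p-1\}$.
   Context: For a complex indeterminate $b$, define polynomials $p_n(b)$ by the formal power series identity $\prod_{k=1}^{\infty} (1-q^k)^{b-1} = \sum_{n=0}^{\infty} \frac{q^n}{n!}\, p_n(b)$. Each $p_n(b)$ is a polynomial of degree $n$ in $b$ with integer coefficients. *)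

(* Defs.v *)
From HB Require Import structures.
From mathcomp Require Import all_boot all_order all_algebra.

Set Implicit Arguments.
Unset Strict Implicit.
Unset Printing Implicit Defensive.
Import Order.TTheory GRing.Theory Num.Theory.
Local Open Scope ring_scope.

(* A formal power series in q over A, given by its coefficient sequence. *)
Definition fps (A : Type) := nat -> A.

Definition fps_one (A : nzRingType) : fps A := fun n => (n == 0%N)%:R.

Definition fps_Xn (A : nzRingType) (k : nat) : fps A := fun n => (n == k)%:R.

Definition fps_sub (A : nzRingType) (f g : fps A) : fps A :=
  fun n => f n - g n.

Definition fps_mul (A : nzRingType) (f g : fps A) : fps A :=
  fun n => \sum_(i < n.+1) f i * g (n - i)%N.

Definition fps_exp (A : nzRingType) (f : fps A) (m : nat) : fps A :=
  iter m (fps_mul f) (fps_one A).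

(* \prod_(k >= 1) F k = L, with convergence in the q-adic topology: every
   coefficient of the partial products is eventually constant. *)
Definition fps_infprod (A : nzRingType) (F : nat -> fps A) (L : fps A) : Prop :=
  forall n, exists N, forall M, (N <= M)%N ->
    (\big[@fps_mul A/@fps_one A]_(1 <= k < M.+1) F k) n = L n.

(* The binomial coefficient a (a - 1) ... (a - m + 1) / m! *)
Definition gbinom (a : {poly rat}) (m : nat) : {poly rat} :=
  (m`!%:R : rat)^-1 *: \prod_(i < m) (a - i%:R).

(* f ^ a = \sum_m gbinom a m (f - 1) ^ m, for f with constant term 1: then
   (f - 1) ^ m has no term of degree < m, so that the terms with m > n do not
   contribute to the coefficient of q ^ n. *)
Definition fps_pow (f : fps {poly rat}) (a : {poly rat}) : fps {poly rat} :=
  fun n => \sum_(m < n.+1)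
    gbinom a m * fps_exp (fps_sub f (fps_one {poly rat})) m n.

(* \prod_(k >= 1) (1 - q ^ k) ^ (b - 1) = \sum_n (q ^ n / n!) p_n(b), an
   identity in Q[b][[q]]; the indeterminate b is 'X. *)
Definition is_pn (pn : nat -> {poly int}) : Prop :=
  fps_infprod
    (fun k => fps_pow (fps_sub (fps_one {poly rat}) (fps_Xn {poly rat} k))
                      ('X - 1))
    (fun n => (n`!%:R : rat)^-1 *: map_poly intr (pn n)).

Definition is_partition (n : nat) (s : seq nat) : bool :=
  [&& sorted geq s, all (fun x => 0 < x)%N s & sumn s == n].

(* A partition of n has at most n parts, all of them at most n, so that all
   the partitions of n are counted. *)
Definition npartitions (n : nat) : nat :=
  #|[set s : {bseq n of 'I_n.+1} | is_partition n (map val s)]|.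

Definition ncoef_mod (p : nat) (f : {poly int}) (r : nat) : nat :=
  count (fun c : int => (c == r %[mod p])%Z) f.

Definition coefs_equidistributed (p : nat) (f : {poly int}) : Prop :=
  forall r s : nat, (0 < r < p)%N -> (0 < s < p)%N ->
    ncoef_mod p f r = ncoef_mod p f s.

(* is_pn determines exactly one sequence of integer polynomials. *)

Definition intp (f : {poly rat}) : Prop :=
  exists P : {poly int}, f = map_poly intr P.

Lemma intp_nat n : intp n%:R.
Proof. by exists n%:R; rewrite rmorph_nat. Qed.

Lemma intpD f g : intp f -> intp g -> intp (f + g).
Proof. by move=> [P ->] [Q ->]; exists (P + Q); rewrite rmorphD. Qed.

Lemma intpB f g : intp f -> intp g -> intp (f - g).
Proof. by move=> [P ->] [Q ->]; exists (P - Q); rewrite rmorphB. Qed.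

Lemma intpM f g : intp f -> intp g -> intp (f * g).
Proof. by move=> [P ->] [Q ->]; exists (P * Q); rewrite rmorphM. Qed.

Lemma intpX : intp 'X.
Proof. by exists 'X; rewrite map_polyX. Qed.

Lemma intp_sum n (F : 'I_n -> {poly rat}) :
  (forall i, intp (F i)) -> intp (\sum_i F i).
Proof.
move=> FP; elim/big_ind: _ => //; [exact: (intp_nat 0) | exact: intpD].
Qed.

Lemma fps_exp_int f m :
  (forall n, intp (f n)) -> forall n, intp (fps_exp f m n).
Proof.
move=> fP; elim: m => [|m IHm] n /=; first exact: intp_nat.
by apply: intp_sum => i; apply: intpM.
Qed.

Definition int_egf (f : fps {poly rat}) : Prop :=
  forall n, intp ((n`!%:R : rat) *: f n).

Lemma factr_neq0 n : (n`!%:R : rat) != 0.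
Proof. by rewrite pnatr_eq0 -lt0n fact_gt0. Qed.

Lemma int_egf_mul f g : int_egf f -> int_egf g -> int_egf (fps_mul f g).
Proof.
move=> fP gP n; rewrite /fps_mul scaler_sumr; apply: intp_sum => i.
have le_in : (i <= n)%N by rewrite -ltnS.
have -> : (n`!%:R : rat) *: (f i * g (n - i)%N)
    = ((i`!%:R *: f i) * ((n - i)`!%:R *: g (n - i)%N)) *+ 'C(n, i).
  rewrite -(bin_fact le_in) !natrM -scalerAl -scalerAr.
  by rewrite -[RHS]scaler_nat !scalerA -mulrA.
by rewrite -mulr_natl; apply: intpM; [exact: intp_nat | exact: intpM].
Qed.

Lemma int_egf_pow f a : (forall n, intp (f n)) -> intp a ->
  int_egf (fps_pow f a).
Proof.
move=> fP aP n; rewrite /fps_pow scaler_sumr; apply: intp_sum => m.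
rewrite scalerAl; apply: intpM; last first.
  by apply: fps_exp_int => i; apply: intpB => //; apply: intp_nat.
have le_mn : (m <= n)%N by rewrite -ltnS.
rewrite /gbinom scalerA -(bin_fact le_mn) mulnCA natrM mulrAC.
rewrite divff ?factr_neq0 // mul1r scaler_nat -mulr_natl.
apply: intpM; first exact: intp_nat.
elim/big_ind: _ => [||i _]; [exact: (intp_nat 1) | exact: intpM |].
by apply: intpB => //; apply: intp_nat.
Qed.

Section Convergence.
Variable A : nzRingType.
Implicit Types (f g : fps A) (F : nat -> fps A).

Definition fps_eq_upto n f g := forall i, (i <= n)%N -> f i = g i.

Lemma fps_mul_upto n f f' g g' : fps_eq_upto n f f' -> fps_eq_upto n g g' ->
  fps_eq_upto n (fps_mul f g) (fps_mul f' g').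
Proof.
move=> eqf eqg i le_in; apply: eq_bigr => j _.
have le_ji : (j <= i)%N by rewrite -ltnS.
by rewrite eqf ?eqg // ?(leq_trans (leq_subr _ _)) // (leq_trans le_ji).
Qed.

Lemma fps_mul1 g n : fps_mul (fps_one A) g n = g n.
Proof.
rewrite /fps_mul big_ord_recl /= subn0 /fps_one /= mul1r big1 ?addr0 // => i _.
by rewrite mul0r.
Qed.

Lemma prod_upto1 n F a b :
    (forall k, (a <= k)%N -> fps_eq_upto n (F k) (fps_one A)) ->
  fps_eq_upto n (\big[@fps_mul A/@fps_one A]_(a <= k < b) F k) (fps_one A).
Proof.
move=> F1; rewrite big_nat.
elim/big_ind: _ => [|f g f1 g1|k /andP[/F1 //]] // i le_in.
by rewrite (fps_mul_upto f1 g1) // fps_mul1.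
Qed.

Lemma prod_stable n F N M a :
    (forall k, (N <= k)%N -> fps_eq_upto n (F k) (fps_one A)) -> (N <= M)%N ->
    (a <= N)%N ->
  fps_eq_upto n (\big[@fps_mul A/@fps_one A]_(a <= k < M) F k)
                (\big[@fps_mul A/@fps_one A]_(a <= k < N) F k).
Proof.
move=> F1 le_NM; move def_d: (N - a)%N => d.
elim: d a def_d => [|d IHd] a def_d le_aN.
  have -> : a = N by apply/eqP; rewrite eqn_leq le_aN -subn_eq0 def_d.
  by rewrite [X in fps_eq_upto _ _ X]big_geq //; apply: prod_upto1.
have lt_aN : (a < N)%N by rewrite -subn_gt0 def_d.
rewrite big_ltn ?(leq_trans lt_aN) // [X in fps_eq_upto _ _ X]big_ltn //.
apply: fps_mul_upto => //.
by apply: IHd => //; rewrite subnS def_d.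
Qed.

Lemma fps_exp_low f m k : (forall i, (i < k)%N -> f i = 0) ->
  forall i, (i < k)%N -> fps_exp f m.+1 i = 0.
Proof.
move=> f0 i lt_ik; rewrite /= /fps_mul big1 // => j _.
by rewrite f0 ?mul0r // (leq_ltn_trans _ lt_ik) // -ltnS.
Qed.

End Convergence.

Lemma fps_pow_upto n k a : (n < k)%N ->
  fps_eq_upto n
    (fps_pow (fps_sub (fps_one {poly rat}) (fps_Xn {poly rat} k)) a)
    (fps_one {poly rat}).
Proof.
move=> lt_nk i le_in; rewrite /fps_pow big_ord_recl big1 ?addr0 => [|m _].
  by rewrite /gbinom big_ord0 invr1 scale1r mul1r.
rewrite (@fps_exp_low _ _ _ k) ?mulr0 ?(leq_ltn_trans le_in) // => j lt_jk.
by rewrite /fps_sub /fps_Xn (ltn_eqF lt_jk) subr0 subrr.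
Qed.

Lemma is_pn_exists : exists pn, is_pn pn.
Proof.
pose F k := fps_pow (fps_sub (fps_one {poly rat}) (fps_Xn {poly rat} k))
                    ('X - 1).
pose L n := (\big[@fps_mul _/@fps_one _]_(1 <= k < n.+1) F k) n.
have LP n : intp ((n`!%:R : rat) *: L n).
  rewrite /L; move: {1 3}n => m; move: m.
  elim/big_ind: _ => [m|f g fP gP|k _].
  - by rewrite scaler_nat -mulr_natl; apply: intpM; apply: intp_nat.
  - exact: int_egf_mul.
  - apply: int_egf_pow => [i|].
      by apply: intpB; apply: intp_nat.
    by apply: intpB; [exact: intpX | exact: (intp_nat 1)].
pose pn n : {poly int} :=
  \poly_(i < size (L n)) numq ((n`!%:R *: L n)`_i).
have pnE n : map_poly intr (pn n) = (n`!%:R : rat) *: L n.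
  have [P defP] := LP n; apply/polyP => i; rewrite coef_map coef_poly /=.
  case: ltnP => [_|le_i]; first by rewrite defP coef_map /= numq_int.
  by rewrite coefZ nth_default ?mulr0.
exists pn => n; exists n => M le_nM.
rewrite pnE scalerA mulVf ?factr_neq0 // scale1r.
by apply: (@prod_stable _ n) => // k lt_nk; apply: fps_pow_upto.
Qed.

Lemma is_pn_unique pn pn' : is_pn pn -> is_pn pn' -> pn =1 pn'.
Proof.
move=> pnP pnP' n; have [N lN] := pnP n; have [N' lN'] := pnP' n.
have := lN (maxn N N') (leq_maxl _ _); rewrite (lN' _ (leq_maxr _ _)).
move/(scalerI (invr_neq0 (factr_neq0 n))) => eq_pn.
by symmetry; apply: map_inj_poly eq_pn => //; apply: intr_inj.
Qed.

(* Main.v *)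
(* Evaluating the defining product at b = m + 1 gives
   p_n(m + 1) = n! [q^n] E^m with E = \prod_k (1 - q^k), and E D(E^m) = m D(E) E^m
   turns into a recurrence whose i-th term carries the falling factorial
   (n - 1) ... (n - i + 1).  Modulo p these vanish beyond a multiple of p, so
   that p_(pm + r) = p_p^m p_r for r < p, and p_p = (-1)^p (b^p - b) because
   p_p vanishes at every residue.  Up to a scalar and a power of b, p_n with
   n = p k + p - 1 is therefore (1 - b^(p-1))^k p_(p-1)(b).
   For k = p m + p - 2 this is C(b^(p(p-1))) f(b), where C = (1 - b)^m and
   f = A(b^(p-1)) p_(p-1)(b) has degree < p(p-1), with
   A = (1 - b)^(p-2) = \sum_i (i + 1) b^i.  Coefficients of C(b^(p(p-1))) f(b)
   are products of one of C and one of f, hence equidistributed if those of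
   either factor are.  In f only the constant and leading terms of p_(p-1)
   overlap: they contribute i (c_0 + c_(p-1)) + c_0 for i < p, where
   c_0 + c_(p-1) = 1 - P(p-1) by Wilson's theorem; this settles (i).  In (ii),
   m = p (j - 1) + p - 2, and C is again a product B(b^p) A(b). *)
Require Import Defs.
From mathcomp Require Import all_boot all_order all_algebra.
From mathcomp Require Import finfield ring zify.

Set Implicit Arguments.
Unset Strict Implicit.
Unset Printing Implicit Defensive.

(** * Values of p_n at integers, and a recurrence in n *)

Section Evaluation.
Import GRing.Theory Num.Theory.
Local Open Scope ring_scope.

Definition one_sub_Xn k : fps {poly rat} :=
  fps_sub (fps_one {poly rat}) (fps_Xn {poly rat} k).

Definition pn_factor k : fps {poly rat} := fps_pow (one_sub_Xn k) ('X - 1).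

(** A polynomial stands in for the power series at [b = v], as only coefficients up to [N] are
    compared. *)
Definition eval_upto N (v : rat) (f : fps {poly rat}) (P : {poly rat}) :=
  forall n, (n <= N)%N -> (f n).[v] = P`_n.

Lemma eval_upto_one N v : eval_upto N v (fps_one {poly rat}) 1.
Proof. by move=> n _; rewrite coef1 /fps_one hornerMn hornerC. Qed.

Lemma eval_upto_mul N v f g P Q : eval_upto N v f P -> eval_upto N v g Q ->
  eval_upto N v (fps_mul f g) (P * Q).
Proof.
move=> fP gQ n le_nN; rewrite coefM horner_sum; apply: eq_bigr => i _.
have le_in : (i <= n)%N by rewrite -ltnS.
by rewrite hornerM fP ?gQ // ?(leq_trans (leq_subr _ _)) // (leq_trans le_in).
Qed.

Lemma eval_upto_exp N v f P m : eval_upto N v f P ->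
  eval_upto N v (fps_exp f m) (P ^+ m).
Proof.
move=> fP; elim: m => [|m IHm]; first exact: eval_upto_one.
by rewrite exprS; apply: eval_upto_mul.
Qed.

Lemma eval_upto_prod N v (F : nat -> fps {poly rat}) (P : nat -> {poly rat}) M :
    (forall k, (0 < k)%N -> eval_upto N v (F k) (P k)) ->
  eval_upto N v (\big[@fps_mul _/@fps_one _]_(1 <= k < M.+1) F k)
                (\prod_(1 <= k < M.+1) P k).
Proof.
move=> FP; rewrite 2!big_nat.
apply: (big_rec2 (eval_upto N v)) => [|k P' f' /andP[k_gt0 _] fP].
  exact: eval_upto_one.
by apply: eval_upto_mul => //; apply: FP.
Qed.

Lemma pn_factor_eval k n v : (pn_factor k n).[v] =
  \sum_(i < n.+1) (gbinom ('X - 1) i).[v] * ((- 'X^k) ^+ i : {poly rat})`_n.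
Proof.
rewrite /pn_factor /fps_pow horner_sum; apply: eq_bigr => i _; rewrite hornerM.
congr (_ * _); apply: (@eval_upto_exp n) => // m _.
rewrite /one_sub_Xn /fps_sub /fps_Xn coefN coefXn addrAC subrr sub0r.
by rewrite hornerN hornerMn hornerC.
Qed.

Lemma gbinom_nat m i : (gbinom ('X - 1) i).[m.+1%:R] = 'C(m, i)%:R :> rat.
Proof.
rewrite /gbinom hornerZ horner_prod.
have -> : \prod_(j < i) ('X - 1 - j%:R : {poly rat}).[m.+1%:R] = (m ^_ i)%:R.
  elim: i => [|i IHi]; first by rewrite big_ord0 ffactn0.
  rewrite big_ord_recr /= {}IHi !hornerE -polyC_natr hornerC.
  rewrite ffactnSr natrM -[m.+1%:R]natr1 addrK.
  have [le_im|lt_mi] := leqP i m; first by rewrite natrB.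
  by rewrite ffact_small // !mul0r.
by rewrite -bin_ffact natrM mulrC mulfK // pnatr_eq0 -lt0n fact_gt0.
Qed.

Lemma gbinom_0 i : (gbinom ('X - 1) i).[0] = (-1) ^+ i :> rat.
Proof.
rewrite /gbinom hornerZ horner_prod.
have -> : \prod_(j < i) ('X - 1 - j%:R : {poly rat}).[0] = (-1) ^+ i * i`!%:R.
  elim: i => [|i IHi]; first by rewrite big_ord0 mulr1.
  rewrite big_ord_recr /= {}IHi !hornerE -polyC_natr hornerC.
  by rewrite factS natrM exprS -natr1; ring.
by rewrite mulrC mulfK // pnatr_eq0 -lt0n fact_gt0.
Qed.

Lemma coef_exprNXn (R : comNzRingType) k i n :
  ((- 'X^k) ^+ i : {poly R})`_n = (-1) ^+ i * (n == k * i)%N%:R.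
Proof. by rewrite -[- 'X^k]scaleN1r exprZn -exprM coefZ coefXn. Qed.

Lemma sum_ord_trunc (V : nmodType) (F : nat -> V) n N : (n <= N)%N ->
  (forall i, (n <= i < N)%N -> F i = 0) -> \sum_(i < N) F i = \sum_(i < n) F i.
Proof.
move=> le_nN F0; rewrite -!(big_mkord xpredT) (big_cat_nat _ le_nN) //=.
by rewrite [X in _ + X]big_nat [X in _ + X]big1 ?addr0.
Qed.

(** The binomial series stops at [i = n], the expanded power at [i = m]. Both give the sum up to
    [maxn m n]: the terms with [i > n] vanish by degree, those with [i > m] by their binomial
    coefficient. *)
Lemma pn_factor_nat N k m : (0 < k)%N ->
  eval_upto N m.+1%:R (pn_factor k) ((1 - 'X^k) ^+ m).
Proof.
move=> k_gt0 n _; rewrite pn_factor_eval exprDn coef_sum.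
pose t i := 'C(m, i)%:R * ((- 'X^k) ^+ i : {poly rat})`_n.
transitivity (\sum_(i < (maxn m n).+1) t i).
  rewrite (@sum_ord_trunc _ t n.+1) ?ltnS ?leq_maxr //.
    by apply: eq_bigr => i _; rewrite gbinom_nat.
  move=> i /andP[lt_ni _]; rewrite /t coef_exprNXn ltn_eqF ?mulr0 //.
  by rewrite (leq_trans lt_ni) // leq_pmull.
rewrite (@sum_ord_trunc _ t m.+1) ?ltnS ?leq_maxl // => [|i /andP[lt_mi _]].
  by apply: eq_bigr => i _; rewrite /t expr1n mul1r coefMn mulr_natl.
by rewrite /t bin_small ?mul0r.
Qed.

(** At [b = 0] the exponent is -1, which gives a geometric series, here truncated. *)
Lemma pn_factor_0 N k : (0 < k)%N ->
  eval_upto N 0 (pn_factor k) (\sum_(i < N.+1) 'X^(k * i)).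
Proof.
move=> k_gt0 n le_nN; rewrite pn_factor_eval coef_sum.
rewrite [RHS](@sum_ord_trunc _ (fun i => ('X^(k * i))`_n) n.+1) //.
  apply: eq_bigr => i _; rewrite gbinom_0 coef_exprNXn coefXn mulrA -exprD addnn.
  by rewrite -signr_odd odd_double mul1r.
move=> i /andP[lt_ni _]; rewrite coefXn ltn_eqF //.
by rewrite (leq_trans lt_ni) // leq_pmull.
Qed.

Variable pn : nat -> {poly int}.
Hypothesis hpn : is_pn pn.

(** Factors with [k > n] do not affect the coefficient of index [n], so a finite product replaces
    the limit. *)
Lemma pn_prod M n : (n <= M)%N ->
  map_poly intr (pn n) = (n`!%:R : rat) *:
    (\big[@fps_mul _/@fps_one _]_(1 <= k < M.+1) pn_factor k) n.
Proof.
move=> le_nM; have [N lN] := hpn n.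
have := lN _ (leq_maxl N M).
have F1 k : (M < k)%N -> fps_eq_upto n (pn_factor k) (fps_one _).
  by move=> lt_Mk; apply: fps_pow_upto; apply: leq_ltn_trans lt_Mk.
rewrite (@prod_stable _ n pn_factor M.+1 _ 1%N F1) ?ltnS ?leq_maxr // => ->.
by rewrite scalerA mulfV ?scale1r // factr_neq0.
Qed.

Definition euler M : {poly int} := \prod_(1 <= k < M.+1) (1 - 'X^k).

Lemma pn_nat M n m : (n <= M)%N ->
  (pn n).[m.+1%:R] = n`!%:R * (euler M ^+ m)`_n.
Proof.
move=> le_nM; apply: (@intr_inj rat).
have -> : (pn n).[m.+1%:R]%:~R = (map_poly intr (pn n)).[m.+1%:R] :> rat.
  by rewrite -horner_map /= rmorph_nat.
rewrite (pn_prod le_nM) hornerZ rmorphM /= rmorph_nat; congr (_ * _).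
have /(_ M M n le_nM) -> := eval_upto_prod _ (fun k => pn_factor_nat m (k:=k)).
rewrite -coef_map rmorphXn /= /euler rmorph_prod /= prodrXl.
congr (((_ : {poly rat}) ^+ m)`_n); apply: eq_bigr => k _.
by rewrite rmorphB rmorph1 /= map_polyXn.
Qed.

Lemma pn_0 n : (pn n).[0] = n`!%:R *
  (\prod_(k < n) \sum_(i < n.+1) 'X^(k.+1 * i) : {poly int})`_n.
Proof.
apply: (@intr_inj rat).
have -> : (pn n).[0]%:~R = (map_poly intr (pn n)).[0] :> rat.
  by rewrite -[0 in RHS](rmorph0 (intr : int -> rat)) horner_map.
rewrite (pn_prod (leqnn n)) hornerZ rmorphM /= rmorph_nat; congr (_ * _).
have /(_ n n (leqnn n)) -> := eval_upto_prod _ (@pn_factor_0 n).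
rewrite -coef_map rmorph_prod big_add1 big_mkord /=.
congr ((_ : {poly rat})`_n); apply: eq_bigr => k _; rewrite rmorph_sum /=.
by apply: eq_bigr => i _; rewrite map_polyXn.
Qed.

(** Otherwise [f - g] would have more roots than its degree allows. Identities in [b] can thus be
    checked at [b = m + 1]. *)
Lemma poly_nat_inj (f g : {poly int}) :
  (forall m : nat, f.[m.+1%:R] = g.[m.+1%:R]) -> f = g.
Proof.
move=> eq_fg; apply/eqP; rewrite -subr_eq0; apply/eqP.
apply: (@roots_geq_poly_eq0 _ _ [seq i.+1%:R | i <- iota 0 (size (f - g))]).
- by apply/allP => _ /mapP[m _ ->]; rewrite /root !hornerE eq_fg subrr.
- rewrite map_inj_uniq ?iota_uniq // => i j /eqP.
  by rewrite eqr_nat eqSS => /eqP.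
- by rewrite size_map size_iota.
Qed.

(** The identity E D(T) = m D(E) T for T = E^m is compared at index n, solved for the coefficient of
    T at n + 1, and multiplied by n!, split as [n ^_ i] times (n - i)!. *)
Lemma pn_rec M n : (n < M)%N ->
  pn n.+1 = \sum_(i < n.+1) ((euler M)`_i.+1 * (n ^_ i)%:R) *:
    ((('X - 1) *+ i.+1 - (n - i)%:R) * pn (n - i)).
Proof.
move=> lt_nM; apply: poly_nat_inj => m.
rewrite (pn_nat m lt_nM); set E := euler M; set T := E ^+ m.
have E0 : E`_0 = 1.
  rewrite -horner_coef0 horner_prod big_nat big1 // => k /andP[k_gt0 _].
  by rewrite !hornerE expr0n gtn_eqF // subr0.
have: (E * T^`())`_n = (m%:R *: (E^`() * T))`_n.
  congr ((_ : {poly int})`_n); rewrite /T deriv_exp -mulr_natl scaler_nat.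
  case: m {T} => [|m]; first by rewrite mulr0n mul0r mulr0.
  by rewrite /= exprS -mulr_natl; ring.
rewrite coefZ !coefM big_ord_recl E0 mul1r subn0 coef_deriv => defT.
have {defT} defT : T`_n.+1 *+ n.+1 =
    \sum_(i < n.+1) E`_i.+1 * (m%:R * i.+1%:R - (n - i)%:R) * T`_(n - i).
  have -> : T`_n.+1 *+ n.+1 = m%:R * (\sum_(i < n.+1) E^`()`_i * T`_(n - i))
       - \sum_(i < n.+1) E`_i.+1 * (n - i)%:R * T`_(n - i).
    (* The last summand vanishes through its factor [n - n]; the others cancel all terms of [defT]
       but the first. *)
    rewrite -defT [in X in _ - X]big_ord_recr /= subnn mulr0 mul0r addr0.
    rewrite -addrA -sumrB big1 ?addr0 // => i _.
    by rewrite /bump add1n coef_deriv -mulr_natr subnSK //; ring.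
  rewrite mulr_sumr -sumrB; apply: eq_bigr => i _.
  by rewrite coef_deriv -mulr_natr; ring.
rewrite factS natrM mulrAC mulrC [n.+1%:R * _]mulr_natl {}defT.
rewrite mulr_sumr horner_sum; apply: eq_bigr => i _.
have le_in : (i <= n)%N by rewrite -ltnS.
rewrite hornerZ hornerM (pn_nat m (leq_trans (leq_subr i n) (ltnW lt_nM))) -/T.
rewrite -(ffact_fact le_in) natrM !hornerE hornerMn !hornerE.
by rewrite -polyC_natr hornerC -[m.+1%:R]natr1 addrK -[m%:R *+ _]mulr_natr /=; ring.
Qed.

End Evaluation.

(** * Partitions counted by a coefficient of a truncated product *)

Section Partitions.

Lemma sumn_multiplicities n s : all (fun x => 0 < x <= n) s ->
  sumn s = \sum_(k < n) k.+1 * count_mem k.+1 s.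
Proof.
elim: s => [|x s IHs] /= => [_|/andP[/andP[x_gt0 le_xn] /IHs->]].
  by rewrite big1 // => k _; rewrite muln0.
under [RHS]eq_bigr do rewrite mulnDr.
rewrite [RHS]big_split /=; congr (_ + _).
have lt_x : x.-1 < n by rewrite prednK.
rewrite (bigD1 (Ordinal lt_x)) //= prednK // eqxx muln1 big1 ?addn0 // => k.
rewrite -val_eqE /= => neq_k.
by rewrite (_ : (x == k.+1) = false) ?muln0 //; lia.
Qed.

Lemma positive_parts_le s : all (fun x => 0 < x) s ->
  size s <= sumn s /\ all (fun x => x <= sumn s) s.
Proof.
elim: s => //= x s IHs /andP[x_gt0 /IHs[le_s /allP s_le]].
split; first lia.
rewrite leq_addr; apply/allP => y /s_le le_y; lia.
Qed.

(** Inverse of the passage to multiplicities: [f k] is the multiplicity of the part [k.+1]. *)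
Definition of_multiplicities n (f : nat -> nat) : seq nat :=
  sort geq (flatten [seq nseq (f k) k.+1 | k <- iota 0 n]).

Lemma count_of_multiplicities n f k :
  count_mem k.+1 (of_multiplicities n f) = (k < n) * f k.
Proof.
rewrite /of_multiplicities.
have /permP -> := permEl (perm_sort geq (flatten [seq nseq (f k) k.+1 | k <- iota 0 n])).
rewrite count_flatten -map_comp sumnE big_map -[n in iota 0 n]subn0.
under eq_bigr do rewrite /= count_nseq /= eqSS.
have [lt_kn|le_nk] := ltnP k n; last first.
  rewrite mul0n big_seq big1 // => i; rewrite mem_index_iota => /andP[_ lt_in].
  by rewrite ltn_eqF //; apply: leq_trans lt_in _.
rewrite (bigD1_seq k) /= ?mem_index_iota ?iota_uniq // eqxx.
by rewrite big1 ?addn0 // => i /negPf->.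
Qed.

Lemma of_multiplicities_bound n f :
  all (fun x => 0 < x <= n) (of_multiplicities n f).
Proof.
apply/allP => x; rewrite mem_sort => /flattenP[_ /mapP[k + ->]].
by rewrite mem_iota mem_nseq => lt_kn /andP[_ /eqP->].
Qed.

Import GRing.Theory.

(** Choosing an exponent in each factor amounts to choosing the multiplicity of each part [k.+1].
    The coefficient therefore counts multiplicity functions, which correspond bijectively to
    partitions. *)
Lemma npartitions_coef n :
  ((npartitions n)%:R =
   (\prod_(k < n) \sum_(i < n.+1) 'X^(k.+1 * i) : {poly int})`_n)%R.
Proof.
pose B := [set f : {ffun 'I_n -> 'I_n.+1} | \sum_(k < n) k.+1 * f k == n].
have -> : ((\prod_(k < n) \sum_(i < n.+1) 'X^(k.+1 * i) : {poly int})`_n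
           = #|B|%:R)%R.
  rewrite bigA_distr_bigA coef_sum -sum1_card natr_sum [RHS]big_mkcond /=.
  apply: eq_bigr => f _; rewrite inE prodrXr coefXn eq_sym.
  by case: ifP.
congr (_%:R)%R; rewrite /npartitions.
pose vs (s : {bseq n of 'I_n.+1}) := map val s.
set A := [set s | _].
have AP s : s \in A -> is_partition n (vs s) by rewrite inE.
have boundP s : is_partition n s -> all (fun x => 0 < x <= n) s.
  case/and3P=> _ s_gt0 /eqP def_n; have [_ le_s] := positive_parts_le s_gt0.
  apply/allP => x s_x; rewrite (allP s_gt0) //=.
  by rewrite -[n in (_ <= n)]def_n (allP le_s).
(* [inord] loses nothing: a sequence of length at most [n] has multiplicities at most [n]. *)
pose g s : {ffun 'I_n -> 'I_n.+1} := [ffun k => inord (count_mem (val k).+1 (vs s))].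
have gE s k : g s k = count_mem (val k).+1 (vs s) :> nat.
  by rewrite ffunE inordK // ltnS (leq_trans (count_size _ _)) // size_map size_bseq.
have g_inj : {in A &, injective g}.
  move=> s t /AP As /AP At eq_g.
  apply/val_inj/(inj_map val_inj); rewrite -/(vs s) -/(vs t).
  case/and3P: (As) => sort_s _ _; case/and3P: (At) => sort_t _ _.
  apply: (sorted_eq _ _ sort_s sort_t).
  - by move=> x y z le_xy le_zx; apply: leq_trans le_zx le_xy.
  - by move=> x y /andP[le_yx le_xy]; apply: anti_leq; apply/andP.
  have out u x : is_partition n u -> ~~ (0 < x <= n) -> count_mem x u = 0.
    move=> Au xP; apply/count_memPn; apply: contra xP => u_x.
    exact: (allP (boundP _ Au)).
  apply/allP => x _ /=; have [xP|xP] := boolP (0 < x <= n); last by rewrite !out.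
  case/andP: xP => x_gt0 le_xn; have lt_x : x.-1 < n by rewrite prednK.
  have := gE s (Ordinal lt_x); rewrite eq_g gE /= prednK // => ->.
  by [].
rewrite -(card_in_imset g_inj); congr #|pred_of_set _|.
apply/setP => f; rewrite inE; apply/imsetP/eqP => [[s As ->]|def_n].
  case/and3P: (AP _ As) => _ _ /eqP sum_s; rewrite -[RHS]sum_s.
  under eq_bigr do rewrite gE.
  by rewrite -sumn_multiplicities // boundP // AP.
(* [f] is extended by 0 to all natural numbers. *)
pose f' k := if insub k is Some k' then val (f k') else 0.
have f'E k : f' (val k) = f k by rewrite /f' valK.
pose u := of_multiplicities n f'.
have u_bound : all (fun x => 0 < x <= n) u := of_multiplicities_bound n f'.
have sum_u : sumn u = n.
  rewrite (sumn_multiplicities u_bound) -[RHS]def_n; apply: eq_bigr => k _.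
  by rewrite count_of_multiplicities ltn_ord mul1n f'E.
have u_gt0 : all (fun x => 0 < x) u by apply: sub_all u_bound => x /andP[].
have size_u : size (map (fun x => inord x : 'I_n.+1) u) <= n.
  by rewrite size_map (leq_trans (positive_parts_le u_gt0).1) // sum_u.
have vs_u : vs (Bseq size_u) = u.
  rewrite /vs /= -map_comp -[RHS]map_id; apply/eq_in_map => x /(allP u_bound).
  by case/andP=> _ le_xn /=; rewrite inordK.
exists (Bseq size_u).
  rewrite inE -/(vs (Bseq size_u)) vs_u /is_partition u_gt0 sum_u eqxx andbT.
  by rewrite andbT /u; apply: sort_sorted => x y; apply: leq_total.
apply/ffunP => k; apply: val_inj.
by rewrite /= gE vs_u count_of_multiplicities ltn_ord mul1n f'E.
Qed.

End Partitions.

(** * Equidistribution of the nonzero values of a sequence *)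

Section Equidistribution.
Import GRing.Theory.
Local Open Scope ring_scope.
Variable F : fieldType.
Implicit Types (u : nat -> F) (c d : F) (f A : {poly F}).

(** The value 0 is exempt, so that padding or shifting by zeros is harmless. *)
Definition equidistributed N u :=
  forall c d, c != 0 -> d != 0 ->
    (\sum_(i < N) (u i == c) = \sum_(i < N) (u i == d))%N.

Lemma eq_equidistributed N u v : (forall i, (i < N)%N -> u i = v i) ->
  equidistributed N u -> equidistributed N v.
Proof.
move=> eq_uv uP c d c0 d0.
have E a : (\sum_(i < N) (v i == a) = \sum_(i < N) (u i == a))%N.
  by apply: eq_bigr => i _; rewrite eq_uv.
by rewrite !E (uP c d).
Qed.

(** A nonzero [a] permutes the nonzero values; for [a = 0] none of them occurs. *)
Lemma equidistributedZ N u a :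
  equidistributed N u -> equidistributed N (fun i => a * u i).
Proof.
move=> uP c d c0 d0; have [->|a0] := eqVneq a 0.
  by under eq_bigr do rewrite mul0r eq_sym (negPf c0);
     under [RHS]eq_bigr do rewrite mul0r eq_sym (negPf d0).
have E b : (\sum_(i < N) ((a * u i)%R == b) = \sum_(i < N) (u i == (a^-1 * b)%R))%N.
  by apply: eq_bigr => i _; rewrite (can2_eq (mulKf a0) (mulVKf a0)).
by rewrite !E (uP (a^-1 * c) (a^-1 * d)) // mulf_neq0 // invr_eq0.
Qed.

Lemma sum_blocks m D (G : nat -> nat) :
  (\sum_(n < D * m) G n = \sum_(i < m) \sum_(k < D) G (D * i + k))%N.
Proof.
elim: m => [|m IHm]; first by rewrite muln0 !big_ord0.
by rewrite mulnS addnC big_ord_recr /= -IHm big_split_ord.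
Qed.

(** The indices form an array with [m] rows of length [D]; counts add up over its rows, and likewise
    over its columns. *)
Lemma equidistributed_rows m D u :
    (forall i, (i < m)%N -> equidistributed D (fun k => u (D * i + k)%N)) ->
  equidistributed (D * m) u.
Proof.
move=> uP c d c0 d0; rewrite (sum_blocks _ _ (fun n => u n == c)).
rewrite (sum_blocks _ _ (fun n => u n == d)).
by apply: eq_bigr => i _; apply: (uP i).
Qed.

Lemma equidistributed_cols m D u :
    (forall k, (k < D)%N -> equidistributed m (fun i => u (D * i + k)%N)) ->
  equidistributed (D * m) u.
Proof.
move=> uP c d c0 d0; rewrite (sum_blocks _ _ (fun n => u n == c)).
rewrite (sum_blocks _ _ (fun n => u n == d)) exchange_big [RHS]exchange_big.
by apply: eq_bigr => k _; apply: (uP k).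
Qed.

Lemma equidistributed_shift e N u : (forall i, (i < e)%N -> u i = 0) ->
  equidistributed N (fun i => u (e + i)%N) -> equidistributed (e + N) u.
Proof.
move=> u0 uP c d c0 d0.
have E a : a != 0 ->
    (\sum_(i < e + N) (u i == a) = \sum_(i < N) (u (e + i)%N == a))%N.
  move=> a0; rewrite big_split_ord /= big1 // => i _.
  by rewrite u0 // eq_sym (negPf a0).
by rewrite !E // (uP c d).
Qed.

Lemma equidistributed_widen M N u : (M <= N)%N ->
    (forall i, (M <= i < N)%N -> u i = 0) ->
  equidistributed N u <-> equidistributed M u.
Proof.
move=> le_MN u0.
have E a : a != 0 -> (\sum_(i < N) (u i == a) = \sum_(i < M) (u i == a))%N.
  move=> a0; rewrite -(subnKC le_MN) big_split_ord /=.
  rewrite [X in (_ + X)%N]big1 ?addn0 // => i _.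
  by rewrite u0 ?leq_addr -?ltn_subRL //= eq_sym (negPf a0).
by split=> uP c d c0 d0; have := uP c d c0 d0; rewrite !E.
Qed.

Definition equidistributed_poly f := equidistributed (size f) (nth 0 f).

Lemma equidistributed_polyP N f : (size f <= N)%N ->
  equidistributed_poly f <-> equidistributed N (nth 0 f).
Proof.
move=> le_fN; symmetry; apply: equidistributed_widen => // i /andP[le_fi _].
exact: nth_default.
Qed.

Lemma equidistributed_poly_mulXn e f :
  equidistributed_poly f -> equidistributed_poly ('X^e * f).
Proof.
move=> fP; apply/(@equidistributed_polyP (e + size f)).
  by rewrite (leq_trans (size_polyMleq _ _)) // size_polyXn.
apply: equidistributed_shift => [i lt_ie|]; first by rewrite coefXnM lt_ie.
apply: eq_equidistributed fP => i _.
by rewrite coefXnM ltnNge leq_addr addKn.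
Qed.

Lemma equidistributed_polyZ a f :
  equidistributed_poly f -> equidistributed_poly (a *: f).
Proof.
move/(equidistributedZ a) => fP; apply/(equidistributed_polyP (size_scale_leq a f)).
by apply: eq_equidistributed fP => i _; rewrite coefZ.
Qed.

(** As [f] has degree below [D], its products with the powers of ['X^D] occupy disjoint blocks. *)
Lemma coef_comp_Xn_mul A f D i k : (size f <= D)%N -> (k < D)%N ->
  ((A \Po 'X^D) * f)`_(D * i + k) = A`_i * f`_k.
Proof.
move=> le_fD lt_kD; have D_gt0 : (0 < D)%N by apply: leq_ltn_trans lt_kD.
have lt_i : (D * i < (D * i + k).+1)%N by rewrite ltnS leq_addr.
rewrite coefM (bigD1 (Ordinal lt_i)) //= addKn coef_comp_poly_Xn //.
rewrite dvdn_mulr // mulKn // big1 ?addr0 // => j; rewrite -val_eqE /= => neq_j.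
rewrite coef_comp_poly_Xn //; case: ifP => [/dvdnP[q def_j]|]; last by rewrite mul0r.
(* Any other contributing [j] is [D * q] with [q < i], which leaves [f] an index of at least [D]. *)
rewrite [f`__]nth_default ?mulr0 // (leq_trans le_fD) //.
have := ltn_ord j; rewrite ltnS => le_j.
have lt_qi : (q < i)%N.
  rewrite ltn_neqAle; apply/andP; split.
    by apply: contraNneq neq_j => eq_qi; rewrite def_j eq_qi mulnC.
  rewrite -ltnS -(ltn_pmul2l D_gt0) mulnS addnC mulnC -def_j.
  by rewrite (leq_ltn_trans le_j) // ltn_add2l.
have: (D * q.+1 <= D * i)%N by rewrite leq_mul2l lt_qi orbT.
rewrite mulnS mulnC -def_j; lia.
Qed.

Lemma size_comp_Xn_mul A f D : (size f <= D)%N ->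
  (size ((A \Po 'X^D) * f)%R <= D * size A)%N.
Proof.
have [->|D_gt0] := posnP D.
  by rewrite leqn0 size_poly_eq0 => /eqP->; rewrite mulr0 size_poly0.
move=> le_fD; apply/leq_sizeP => n le_n.
rewrite (divn_eq n D) mulnC coef_comp_Xn_mul ?ltn_pmod //.
by rewrite [A`__]nth_default ?mul0r // leq_divRL // mulnC.
Qed.

(** In the array of coefficients, each row is a multiple of [f] and each column a multiple of
    [A]. *)
Lemma equidistributed_poly_comp_mul A f D : (size f <= D)%N ->
    equidistributed_poly A \/ equidistributed_poly f ->
  equidistributed_poly ((A \Po 'X^D) * f).
Proof.
move=> le_fD AfP; apply/(equidistributed_polyP (size_comp_Xn_mul A le_fD)).
case: AfP => [AP|/(equidistributed_polyP le_fD) fP].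
  apply: equidistributed_cols => k lt_kD.
  apply: eq_equidistributed (equidistributedZ f`_k AP) => i _.
  by rewrite coef_comp_Xn_mul // mulrC.
apply: equidistributed_rows => i _.
apply: eq_equidistributed (equidistributedZ A`_i fP) => k lt_kD.
by rewrite coef_comp_Xn_mul.
Qed.

End Equidistribution.

(** * Reduction modulo p and powers of 1 - X *)

Section ModP.
Import GRing.Theory.
Local Open Scope ring_scope.

Variable p : nat.
Hypothesis p_pr : prime p.

Let p_gt0 : (0 < p)%N := prime_gt0 p_pr.
Let p_gt1 : (1 < p)%N := prime_gt1 p_pr.
Let p0 : p%:R = 0 :> 'F_p := pchar_Fp_0 p_pr.

Lemma ncoef_mod_Fp (f : {poly int}) r : (0 < r < p)%N ->
  ncoef_mod p f r =
  (\sum_(i < size f) ((map_poly intr f : {poly 'F_p})`_i == r%:R)%R)%N.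
Proof.
move=> rP; rewrite /ncoef_mod -sum1_count big_mkcond (big_nth 0) big_mkord.
apply: eq_bigr => i _; rewrite coef_map /= eqz_mod_dvd.
rewrite (dvdz_pcharf (pchar_Fp p_pr)) rmorphB /= -pmulrn subr_eq0.
by case: (_ == _).
Qed.

Lemma coefs_equidistributed_Fp (f : {poly int}) :
  equidistributed_poly (map_poly intr f : {poly 'F_p}) ->
  coefs_equidistributed p f.
Proof.
move/(equidistributed_polyP (size_poly _ _)) => fP r s rP sP.
have nz t : (0 < t < p)%N -> t%:R != 0 :> 'F_p.
  case/andP=> t_gt0 lt_tp; rewrite -(dvdn_pcharf (pchar_Fp p_pr)).
  by rewrite gtnNdvd.
by rewrite !ncoef_mod_Fp //; apply: fP; apply: nz.
Qed.

(** An injective map between sets of [p] elements takes each value exactly once. *)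
Lemma sum_Fp_affine (a b c : 'F_p) : a != 0 ->
  (\sum_(i < p) ((a * (i : nat)%:R + b)%R == c) = 1)%N.
Proof.
move=> a0; pose h (i : 'I_p) : 'F_p := a * (i : nat)%:R + b.
have h_inj : injective h.
  move=> i j /addIr/(mulfI a0)/(congr1 val); rewrite /= !val_Fp_nat //.
  by rewrite !modn_small // => /val_inj.
have [h' hK h'K] : bijective h.
  by apply: inj_card_bij h_inj _; rewrite card_Fp ?card_ord.
rewrite (bigD1 (h' c)) //= -/(h (h' c)) h'K eqxx big1 // => i neq_i.
by rewrite -/(h i) (can2_eq hK h'K) (negPf neq_i).
Qed.

Lemma equidistributed_affine (a b : 'F_p) : a != 0 ->
  equidistributed p (fun i => a * i%:R + b).
Proof. by move=> a0 c d _ _; rewrite !sum_Fp_affine. Qed.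

Lemma exp_one_sub_p (f : {poly 'F_p}) : (1 - f) ^+ p = 1 - f ^+ p.
Proof.
have p_char : p \in [pchar {poly 'F_p}].
  by rewrite inE p_pr -polyC_natr p0 polyC0 eqxx.
rewrite -!(pFrobenius_autE p_char) pFrobenius_autB_comm; last exact: mulrC.
by rewrite pFrobenius_aut1.
Qed.

(* [(1 - X)^(p - 1) = 1 + X + ... + X^(p - 1)] in characteristic [p]; the
   derivative of both sides gives the coefficients of [(1 - X)^(p - 2)]. *)
Lemma coef_exp_one_subX i : (i < p)%N ->
  ((1 - 'X : {poly 'F_p}) ^+ (p - 2))`_i = i.+1%:R.
Proof.
move=> lt_ip.
have geom : (1 - 'X : {poly 'F_p}) ^+ p.-1 = \poly_(j < p) 1.
  apply: (@mulfI _ (1 - 'X)).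
    by rewrite -opprB oppr_eq0 -polyC1 polyXsubC_eq0.
  rewrite -exprS prednK // exp_one_sub_p -opprB subrX1 -mulNr opprB.
  by rewrite poly_def; congr (_ * _); apply: eq_bigr => j _; rewrite scale1r.
have /(congr1 (fun f : {poly 'F_p} => f^`()`_i)) := geom.
rewrite deriv_exp derivB derivX derivC sub0r coef_deriv coef_poly.
have p1 : p.-1%:R = -1 :> {poly 'F_p}.
  by apply/eqP; rewrite -subr_eq0 opprK natr1 prednK // -polyC_natr p0.
have Np1 (f : {poly 'F_p}) : - f *+ p.-1 = f.
  by rewrite -mulr_natr p1 mulrN1 opprK.
rewrite mulN1r Np1 (_ : p.-1.-1 = p - 2)%N; last by rewrite subn2.
move=> ->; case: ltnP => // le_pi.
by rewrite mul0rn (_ : i.+1 = p) ?p0 //; apply/eqP; rewrite eqn_leq lt_ip.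
Qed.


Lemma size_exp_one_subX m : (size ((1 - 'X : {poly 'F_p}) ^+ m) = m.+1)%N.
Proof.
by rewrite -opprB -polyC1 exprNn size_Msign size_exp_XsubC.
Qed.

(** For [i < p] the coefficients i + 1 run once through all residues; the index p - 1, beyond the
    degree, supplies 0. *)
Lemma equidistributed_one_subX : equidistributed_poly ((1 - 'X : {poly 'F_p}) ^+ (p - 2)).
Proof.
apply/(@equidistributed_polyP _ p); first by rewrite size_exp_one_subX; lia.
apply: eq_equidistributed (equidistributed_affine 1 (oner_neq0 _)) => i lt_ip.
by rewrite coef_exp_one_subX // mul1r natr1.
Qed.

Lemma exp_one_subX_split m :
  (1 - 'X : {poly 'F_p}) ^+ (p * m + (p - 2)) =
  ((1 - 'X) ^+ m \Po 'X^p) * (1 - 'X) ^+ (p - 2).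
Proof.
by rewrite exprD exprM exp_one_sub_p rmorphXn rmorphB /= comp_polyX comp_polyC.
Qed.

Lemma equidistributed_one_subX_ext m :
  equidistributed_poly ((1 - 'X : {poly 'F_p}) ^+ (p * m + (p - 2))).
Proof.
rewrite exp_one_subX_split; apply: equidistributed_poly_comp_mul.
  by rewrite size_exp_one_subX; lia.
by right; apply: equidistributed_one_subX.
Qed.

(** The degree is at most (p - 1)(p - 2) + (p - 1) = (p - 1)^2. *)
Lemma size_overlap (G : {poly 'F_p}) : (size G <= p)%N ->
  leq (size (((1 - 'X) ^+ (p - 2) \Po 'X^(p.-1)) * G)) (p.-1 * p).
Proof.
move=> le_Gp; apply: leq_trans (size_polyMleq _ _) _.
have := size_comp_poly_leq ((1 - 'X : {poly 'F_p}) ^+ (p - 2)) 'X^(p.-1).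
rewrite size_exp_one_subX size_polyXn /=; set s := size (_ \Po _).
move: (size G) s le_Gp; case: (p) p_gt1 => [|[|q]] // _; rewrite subn2 /=; nia.
Qed.

(** [G] may have one coefficient more than the block length p - 1, so its top one spills into column
    0 of the next block. Column 0 is thus affine in the row, with nonzero slope by hypothesis; the
    other columns are multiples of (1 - X)^(p - 2). *)
Lemma equidistributed_overlap (G : {poly 'F_p}) :
    (size G <= p)%N -> G`_0 + G`_p.-1 != 0 ->
  equidistributed_poly (((1 - 'X) ^+ (p - 2) \Po 'X^(p.-1)) * G).
Proof.
move=> le_Gp G0; set A := (1 - 'X) ^+ (p - 2); set d := p.-1 in G0 *.
have d_gt0 : (0 < d)%N by rewrite /d -subn1 subn_gt0.
pose H := \poly_(i < d) G`_i; set c := G`_d in G0.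
have defG : G = H + c *: 'X^d.
  apply/polyP => i; rewrite coefD coefZ coefXn coef_poly.
  case: (ltngtP i d) => [||->]; rewrite ?mulr0 ?addr0 ?add0r ?mulr1 // => lt_di.
  by rewrite nth_default // (leq_trans le_Gp) // -(prednK p_gt0).
have le_Hd : (size H <= d)%N := size_poly _ _.
have le_1d : leq (size (1 : {poly 'F_p})) d by rewrite size_poly1.
have size_A : size A = (p - 2)%N.+1 := size_exp_one_subX _.
(* The top term of [G] is absorbed as a factor ['X] of [A], so that both cofactors have degree below
   [d]. *)
have defAG : (A \Po 'X^d) * G = (A \Po 'X^d) * H + c *: (((A * 'X) \Po 'X^d) * 1).
  by rewrite {1}defG mulr1 comp_polyM comp_polyX mulrDr -scalerAr.
apply/(equidistributed_polyP (size_overlap le_Gp)).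
rewrite defAG; apply: equidistributed_cols => k lt_kd.
have [->|k_neq0] := eqVneq k 0%N.
  apply: eq_equidistributed (equidistributed_affine G`_0 G0) => i lt_ip.
  rewrite coefD coefZ !coef_comp_Xn_mul // coef1 mulr1 coefMX.
  rewrite coef_exp_one_subX // coef_poly d_gt0.
  case: i lt_ip => [|i] lt_ip /=; first by rewrite !mulr0 !mul1r addr0 add0r.
  by rewrite coef_exp_one_subX ?(ltnW lt_ip) // -(natr1 i.+1); ring.
have AP := (equidistributed_polyP (_ : size A <= p)%N).1 equidistributed_one_subX.
apply: eq_equidistributed (equidistributedZ H`_k (AP _)) => [i _|].
  rewrite coefD coefZ !coef_comp_Xn_mul // coef1 (negPf k_neq0) !mulr0 addr0.
  exact: mulrC.
by rewrite size_A; lia.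
Qed.

(** * The polynomials p_n modulo p *)

Variable pn : nat -> {poly int}.
Hypothesis hpn : is_pn pn.

Definition pn_Fp n : {poly 'F_p} := map_poly intr (pn n).

(** The factors agree modulo p up to r - r = 0; from there on both products vanish. *)
Lemma ffact_Fp m r i : ((p * m + r) ^_ i)%:R = (r ^_ i)%:R :> 'F_p.
Proof.
elim: i => [|i IHi]; first by rewrite !ffactn0.
rewrite !ffactnSr !natrM IHi; have [le_ir|lt_ri] := leqP i r.
  by rewrite -addnBA // natrD natrM p0 mul0r add0r.
by rewrite (ffact_small lt_ri) !mul0r.
Qed.

Lemma pn_rec_Fp M n : (n < M)%N ->
  pn_Fp n.+1 = \sum_(i < n.+1) (((euler M)`_i.+1)%:~R * (n ^_ i)%:R) *:
    ((('X - 1) *+ i.+1 - (n - i)%:R) * pn_Fp (n - i)).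
Proof.
move=> lt_nM; rewrite /pn_Fp (pn_rec hpn lt_nM) rmorph_sum /=.
apply: eq_bigr => i _.
rewrite map_polyZ rmorphM /= rmorph_nat rmorphM rmorphB rmorphMn rmorphB /=.
by rewrite map_polyX rmorph1 rmorph_nat.
Qed.

Lemma pn_Fp0 : pn_Fp 0%N = 1.
Proof.
rewrite /pn_Fp; suff -> : pn 0%N = 1 by rewrite rmorph1.
apply: poly_nat_inj => m; rewrite (pn_nat hpn m (leqnn 0)) /euler.
by rewrite big_geq // expr1n coef1 mul1r hornerC.
Qed.

(* In the recurrence at [n + 1] with [n = p m + r] and [r < p], the falling
   factorials of [n] of order [> r] contain the factor [p m]. *)
Lemma pn_Fp_mul m r : (r <= p)%N -> pn_Fp (p * m + r) = pn_Fp (p * m) * pn_Fp r.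
Proof.
elim/ltn_ind: r => [[|r]] IHr lt_rp; first by rewrite addn0 pn_Fp0 mulr1.
rewrite addnS (pn_rec_Fp (ltnSn (p * m + r))) (@pn_rec_Fp (p * m + r).+1 r); last first.
  by rewrite ltnS leq_addl.
pose n := (p * m + r)%N.
pose t i := (((euler n.+1)`_i.+1)%:~R * (n ^_ i)%:R : 'F_p) *:
    ((('X - 1) *+ i.+1 - (n - i)%:R) * pn_Fp (n - i)).
rewrite -/n (@sum_ord_trunc _ t r.+1) ?ltnS ?leq_addl // => [|i /andP[lt_ri _]].
  rewrite mulr_sumr; apply: eq_bigr => i _.
  have le_ir : (i <= r)%N by rewrite -ltnS.
  rewrite /t /n ffact_Fp -addnBA // IHr; first last.
  - by rewrite (leq_trans (leq_subr _ _)) // ltnW.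
  - by rewrite ltnS leq_subr.
  rewrite natrD -scalerAr; congr (_ *: _).
  have -> : (p * m)%:R = 0 :> {poly 'F_p} by rewrite -polyC_natr natrM p0 mul0r.
  by rewrite add0r mulrCA.
by rewrite /t /n ffact_Fp ffact_small // mulr0 scale0r.
Qed.

Lemma coef1_euler M : (0 < M)%N -> (euler M)`_1 = -1.
Proof.
elim: M => // -[|M] IHM _.
  by rewrite /euler big_nat1 coefB coef1 coefX sub0r.
rewrite /euler big_nat_recr //= -/(euler M.+1) mulrBr mulr1 coefB IHM //.
by rewrite coefMXn subr0.
Qed.

(** Only the term [i = 0] of the recurrence reaches degree n + 1; it multiplies p_n by -(b - 1 -
    n). *)
Lemma pn_Fp_lead n : (size (pn_Fp n) <= n.+1)%N /\ (pn_Fp n)`_n = (-1) ^+ n.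
Proof.
elim/ltn_ind: n => [[|n]] IHn; first by rewrite pn_Fp0 size_poly1 coef1.
have size_t i : (i <= n)%N ->
    (size (((('X - 1) *+ i.+1 - (n - i)%:R) * pn_Fp (n - i))%R : {poly 'F_p})
       <= (n - i).+2)%N.
  move=> le_in; rewrite (leq_trans (size_polyMleq _ _)) //.
  have [|le_s _] := IHn (n - i)%N; first by rewrite ltnS leq_subr.
  have: (size ((('X - 1) *+ i.+1 - (n - i)%:R)%R : {poly 'F_p}) <= 2)%N.
    apply/leq_sizeP => -[|[|j]] // _.
    by rewrite coefB coefMn coefB coefX coef1 -polyC_natr coefC subrr mul0rn subr0.
  by move: le_s; lia.
rewrite (pn_rec_Fp (ltnSn n)); split.
  apply/leq_sizeP => j lt_nj; rewrite coef_sum big1 // => i _.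
  have le_in : (i <= n)%N by rewrite -ltnS.
  rewrite coefZ [X in _ * X]nth_default ?mulr0 //; apply: leq_trans (size_t _ le_in) _.
  by rewrite (leq_trans _ lt_nj) // !ltnS leq_subr.
rewrite coef_sum big_ord_recl big1 ?addr0 => [|i _].
  have [le_s lead_n] := IHn n (ltnSn n).
  rewrite subn0 ffactn0 coef1_euler // mulr1 mulr1n -addrA -opprD mulrBl coefZ.
  rewrite coefB coefXM /= lead_n -polyC1 -polyC_natr -polyCD coefCM.
  by rewrite [_`_n.+1]nth_default // mulr0 subr0 rmorphN1 exprS.
have le_in : (i.+1 <= n)%N by rewrite ltn_ord.
rewrite coefZ [X in _ * X]nth_default ?mulr0 //; apply: leq_trans (size_t _ le_in) _.
by rewrite ltnS ltn_subrL (leq_trans _ le_in).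
Qed.

Lemma expf_p (x : 'F_p) : x ^+ p = x.
Proof. by have := expf_card x; rewrite card_Fp. Qed.

(** The values carry the factor p!, so every residue is a root. The two sides share their leading
    term, and a difference of degree below p cannot have p roots. *)
Lemma pn_Fp_p : pn_Fp p = (-1) ^+ p *: ('X^p - 'X).
Proof.
have [le_s lead_p] := pn_Fp_lead p.
apply/eqP; rewrite -subr_eq0; apply/eqP.
apply: (@roots_geq_poly_eq0 _ _ (enum 'F_p)); rewrite ?enum_uniq //.
  apply/allP => x _; rewrite /root !hornerE.
  rewrite (expf_p x).
  rewrite subrr mulr0 subr0.
  (* Adding p makes x - 1 a natural number [m] even for x = 0. *)
  have -> : x = (x + p%:R - 1 + 1) by rewrite p0 addr0 subrK.
  have [m ->] : exists m : nat, x + p%:R - 1 = m%:R.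
    exists (x + (p - 1))%N; rewrite natrD natr_Zp natrB //.
    by rewrite addrA.
  rewrite natr1 -(rmorph_nat intr) horner_map /= (pn_nat hpn m (leqnn p)).
  rewrite rmorphM /= rmorph_nat -[in p`!](prednK p_gt0) factS prednK // natrM p0.
  by rewrite !mul0r.
rewrite -cardE card_Fp //; apply/leq_sizeP => j le_pj.
rewrite coefB coefZ coefB coefXn coefX (gtn_eqF (leq_trans p_gt1 le_pj)) subr0.
have [->|neq_j] := eqVneq j p; first by rewrite lead_p mulr1 subrr.
rewrite mulr0 subr0 nth_default // (leq_trans le_s) //.
by rewrite ltn_neqAle eq_sym neq_j.
Qed.

Lemma pn_Fp_mul_p m : pn_Fp (p * m) = pn_Fp p ^+ m.
Proof.
elim: m => [|m IHm]; first by rewrite muln0 pn_Fp0.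
by rewrite mulnS addnC pn_Fp_mul // IHm exprSr.
Qed.

(** The value at [b = 0] is (p - 1)! P(p - 1), and (p - 1)! = -1 by Wilson's theorem. *)
Lemma pn_Fp_coef0 : (pn_Fp p.-1)`_0 = - (npartitions p.-1)%:R.
Proof.
rewrite coef_map /= -horner_coef0 (pn_0 hpn) -npartitions_coef rmorphM /= !rmorph_nat.
have -> : p.-1`!%:R = -1 :> 'F_p.
  apply/eqP; rewrite -subr_eq0 opprK natr1 -(dvdn_pcharf (pchar_Fp p_pr)).
  by rewrite -Wilson.
by rewrite mulN1r.
Qed.

Lemma pn_Fp_form m : pn_Fp (p * (p * m + (p - 2)) + p.-1) =
  (- (-1) ^+ p) ^+ (p * m + (p - 2)) *: ('X^(p * m + (p - 2)) *
   (((1 - 'X) ^+ m \Po 'X^(p.-1 * p)) *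
    (((1 - 'X) ^+ (p - 2) \Po 'X^(p.-1)) * pn_Fp p.-1))).
Proof.
rewrite pn_Fp_mul ?leq_pred // pn_Fp_mul_p pn_Fp_p; set k := (p * m + (p - 2))%N.
have -> : (-1) ^+ p *: ('X^p - 'X) =
    (- (-1) ^+ p) *: ('X * (1 - 'X^(p.-1))) :> {poly 'F_p}.
  by rewrite mulrBr mulr1 -exprS prednK // scaleNr -scalerN opprB.
rewrite exprZn exprMn -!scalerAl -mulrA; congr (_ *: (_ * _)); rewrite mulrA.
congr (_ * _); have -> : 1 - 'X^(p.-1) = (1 - 'X) \Po 'X^(p.-1) :> {poly 'F_p}.
  by rewrite rmorphB /= comp_polyX comp_polyC.
rewrite -rmorphXn /= exp_one_subX_split rmorphM /=; congr (_ * _).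
by rewrite -comp_polyA comp_Xn_poly -exprM.
Qed.

(** Either the outer factor (1 - X)^m or the inner block is equidistributed, and one of them
    suffices. *)
Lemma equidistributed_pn m :
    equidistributed_poly ((1 - 'X : {poly 'F_p}) ^+ m) \/
      (npartitions p.-1)%:R != 1 :> 'F_p ->
  coefs_equidistributed p (pn (p * (p * m + (p - 2)) + p.-1)).
Proof.
move=> mP; apply: coefs_equidistributed_Fp; rewrite -/(pn_Fp _) pn_Fp_form.
have [le_s lead_p] := pn_Fp_lead p.-1; rewrite prednK // in le_s.
apply/equidistributed_polyZ/equidistributed_poly_mulXn.
apply: equidistributed_poly_comp_mul; last first.
  case: mP => [|neq1]; [by left | right].
  apply: equidistributed_overlap => //; rewrite lead_p pn_Fp_coef0.
  (* Fermat's little theorem at -1 covers p = 2 as well. *)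
  have -> : (-1) ^+ p.-1 = 1 :> 'F_p.
    apply: (@mulfI _ (-1)); first by rewrite oppr_eq0 oner_neq0.
    by rewrite -exprS prednK // expf_p mulr1.
  by rewrite addrC subr_eq0 eq_sym.
exact: size_overlap.
Qed.

End ModP.

(** * The two arithmetic progressions *)

Theorem theorem3p3 (pn : nat -> {poly int}) (hpn : is_pn pn)
    (p : nat) (hp : prime p) :
  (~ (npartitions (p - 1) = 1 %[mod p])%N ->
     forall j : nat, (1 <= j)%N ->
       coefs_equidistributed p (pn (p ^ 2 * j - p - 1)%N)) /\
  ((npartitions (p - 1) = 1 %[mod p])%N ->
     forall j : nat, (1 <= j)%N ->
       coefs_equidistributed p (pn (p ^ 3 * j - p ^ 2 - p - 1)%N)).
Proof.
have p_gt1 := prime_gt1 hp; split=> [neq1|_] [|m] // _.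
  have -> : p ^ 2 * m.+1 - p - 1 = p * (p * m + (p - 2)) + p.-1.
    by case: p p_gt1 {hp neq1} => [|[|q]] //= _; nia.
  apply: equidistributed_pn => //; right; apply/negP=> eq1; apply: neq1.
  by rewrite subn1 -!val_Fp_nat // (eqP eq1).
(* The outer factor is now (1 - X)^(p m + p - 2), where j = m + 1. *)
have -> : p ^ 3 * m.+1 - p ^ 2 - p - 1
    = p * (p * (p * m + (p - 2)) + (p - 2)) + p.-1.
  case: p p_gt1 {hp} => [|[|q]] //= _; rewrite !expnS expn0; nia.
by apply: equidistributed_pn => //; left; apply: equidistributed_one_subX_ext.
Qed.
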